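(* Let $G$ be a finite acyclic directed graph, and let $\mathcal L(G)$ be the lattice of maximal orthogonal pairs of $G$. If $\mathcal L(G)$ is trim, then $\mathcal L(G)\simeq\mathrm{top}(G)$ as posets.
   Context: All directed graphs are finite, acyclic (no directed cycles, hence no loops) and without multiple edges; $g\in G$ means $g$ is a vertex of $G$, and $g\to h$ denotes an edge from $g$ to $h$. The $G$-order is the partial order on vertices with $g_1\ge g_2$ iff there is a directed path (possibly of length $0$) from $g_1$ to $g_2$. An independent set is a set of pairwise non-adjacent vertices. A pair $(\mathcal D,\mathcal U)$ of disjoint independent sets is orthogonal if there is no edge from an element of $\mathcal D$ to an element of $\mathcal U$. An orthogonal pair of independent sets is tight if none of the following operations results in an orthogonal pair of independent sets: removing some $d\in\mathcal D$ and inserting in $\mathcal D$ an element $d'\notin\mathcal D$ with $d'>d$; removing some $u\in\mathcal U$ and inserting in $\mathcal U$ an element $u'\notin\mathcal U$ with $u'<u$; adding a new element to $\mathcal D$; adding a new element to $\mathcal U$. A tight orthogonal pair is called a top, and $\mathrm{top}(G)$ is the set of tops of $G$. A linear extension $\ell$ of $G$-order is a total order on the vertices such that if $g_1\to g_2$ is an edge then $g_2$ precedes $g_1$; a reverse linear extension $\ell'$ is a total order in which $g_1$ precedes $g_2$ whenever $g_1\to g_2$. Flips: for $(\mathcal D,\mathcal U)\in\mathrm{top}(G)$ and $g\in G$, define $\mathrm{flip}_g(\mathcal D,\mathcal U)=(\mathcal D,\mathcal U)$ if $g\notin\mathcal D\cup\mathcal U$. Otherwise start with $\mathcal D'=\{k\in\mathcal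 D: k\not\le g\}$ and $\mathcal U'=\{k\in\mathcal U:k\not\ge g\}$; add $g$ to $\mathcal D'$ if $g\in\mathcal U$, and add $g$ to $\mathcal U'$ if $g\in\mathcal D$. Then, for $k\not\ge g$ in the order of a reverse linear extension $\ell'$, add $k$ to $\mathcal D'$ if $k\notin\mathcal U'$, there is no edge from $k$ to $\mathcal U'$, and there is no edge from the current $\mathcal D'$ to $k$. Then, for $k\not\le g$ in the order of a linear extension $\ell$, add $k$ to $\mathcal U'$ if $k\notin\mathcal D'$, there is no edge from $\mathcal D'$ to $k$, and there is no edge from $k$ to the current $\mathcal U'$. The result $(\mathcal D',\mathcal U')$ is $\mathrm{flip}_g(\mathcal D,\mathcal U)$; it is a top and does not depend on the choice of $\ell,\ell'$. The independence poset, also denoted $\mathrm{top}(G)$, is the set $\mathrm{top}(G)$ with the reflexive and transitive closure of the relations $(\mathcal D,\mathcal U)<\mathrm{flip}_g(\mathcal D,\mathcal U)$ for $g\in\mathcal U$ (this is a partial order). Maximal orthogonal pairs: a pair $(X,Y)$ of disjoint sets of vertices (not necessarily independent) with no edge from an element of $X$ to an element of $Y$ is a maximal orthogonal pair (mop) if $X$ and $Y$ are both maximal with this property. $\mathcal L(G)$ is the set of mops ordered by $(X,Y)\le(X',Y')$ iff $X\subseteq X'$ (equivalently $Y'\subseteq Y$); it is an extremal lattice. A chain $x_0<x_1<\cdots<x_r$ has length $r$. A finite lattice is extremal if the length of its longest chain equals both its number of join-irreducible elements and its number of meet-irreducible elements. An element $x$ of a lattice is left modular if $(y\vee x)\wedge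 z=y\vee(x\wedge z)$ for all $y\le z$; a lattice is left modular if it has a maximal chain of left modular elements. A trim lattice is an extremal left modular lattice.
   Formalization: Tightness is corrected: one may remove one or more elements of D all below the inserted d' (dually for U), not only a single one; with single replacements the claim fails, e.g. for edges 3→2, 4→2, 2→0, 2→1. *)

(* Defs.v *)
From HB Require Import structures.
From mathcomp Require Import all_boot all_order.

Set Implicit Arguments.
Unset Strict Implicit.
Unset Printing Implicit Defensive.

Import Order.TTheory.

(* A directed graph without multiple edges is a finite type T of vertices with
   a relation e : rel T, where e g h stands for the edge g -> h. *)
Section Digraph.

Variables (T : finType) (e : rel T).
Implicit Types (A B X Y D U : {set T}) (g k x y : T) (l : seq T).

(* Since cycle e [:: g] = e g g, this also excludes loops. *)
Definition acyclic : Prop := forall c : seq T, cycle e c -> c = [::].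

(* h <= g in the G-order iff there is a directed path from g to h. *)
Definition gle : rel T := fun h g => connect e g h.
Definition glt : rel T := fun h g => (h != g) && gle h g.

Definition no_edge A B : bool := [forall x in A, forall y in B, ~~ e x y].

Definition independent A : bool := no_edge A A.

Definition orthogonal_pair X Y : bool := [disjoint X & Y] && no_edge X Y.

Definition orthogonal_indep D U : bool :=
  [&& independent D, independent U & orthogonal_pair D U].

(* An increase removes some elements of D and inserts a vertex d' outside D that
   is larger than all of them; a decrease of U is dual. More than one element
   may have to be removed, since d' may be adjacent to several elements of D.
   If only single elements were replaced, an independent set D could belong to
   several tight pairs: for the edges 3 -> 2, 4 -> 2, 2 -> 0, 2 -> 1, both
   ({0,1}, {2}) and ({0,1}, {3,4}) would be tight, although the latter can be
   decreased to the former. *)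
Definition tight D U : bool :=
  [&& orthogonal_indep D U,
      [forall A : {set T}, forall d',
         [&& A != set0, A \subset D, d' \notin D & [forall d in A, glt d d']]
           ==> ~~ orthogonal_indep (d' |: (D :\: A)) U],
      [forall A : {set T}, forall u',
         [&& A != set0, A \subset U, u' \notin U & [forall u in A, glt u' u]]
           ==> ~~ orthogonal_indep D (u' |: (U :\: A))],
      [forall d, (d \notin D) ==> ~~ orthogonal_indep (d |: D) U]
    & [forall u, (u \notin U) ==> ~~ orthogonal_indep D (u |: U)]].

Record top : predArgType := Top {
  top_val : {set T} * {set T};
  _ : tight top_val.1 top_val.2
}.

HB.instance Definition _ := [isSub for top_val].
HB.instance Definition _ := [Finite of top by <:].

(* A total order on the vertices is represented by the list of all vertices in
   increasing order. *)
Definition vertex_enumeration l : Prop := uniq l /\ forall x, x \in l.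

Definition linear_extension l : Prop :=
  vertex_enumeration l /\ forall x y, e x y -> index y l < index x l.

Definition reverse_linear_extension l : Prop :=
  vertex_enumeration l /\ forall x y, e x y -> index x l < index y l.

Definition add_down U D k : {set T} :=
  if [&& k \notin U, no_edge [set k] U & no_edge D [set k]] then k |: D else D.

Definition add_up D U k : {set T} :=
  if [&& k \notin D, no_edge D [set k] & no_edge [set k] U] then k |: U else U.

Definition flip (l l' : seq T) g (p : {set T} * {set T}) : {set T} * {set T} :=
  let: (D, U) := p in
  if g \notin D :|: U then p else
  let D0 := [set k in D | ~~ gle k g] :|: (if g \in U then [set g] else set0) in
  let U0 := [set k in U | ~~ gle g k] :|: (if g \in D then [set g] else set0) in
  let D1 := foldl (add_down U0) D0 [seq k <- l' | ~~ gle g k] in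
  let U1 := foldl (add_up D1) U0 [seq k <- l | ~~ gle k g] in
  (D1, U1).

Definition flip_up (l l' : seq T) : rel top := fun p q =>
  [exists g in (top_val p).2, top_val q == flip l l' g (top_val p)].

(* connect is the reflexive transitive closure. *)
Definition top_le (l l' : seq T) : rel top := connect (flip_up l l').

Definition is_mop X Y : bool :=
  maxset (fun X' => orthogonal_pair X' Y) X &&
  maxset (fun Y' => orthogonal_pair X Y') Y.

Record mop : predArgType := Mop {
  mop_val : {set T} * {set T};
  _ : is_mop mop_val.1 mop_val.2
}.

HB.instance Definition _ := [isSub for mop_val].
HB.instance Definition _ := [Finite of mop by <:].

End Digraph.

(* flip depends formally on l and l'; such lists exist, so quantifying over all of
   them is never vacuous. *)
Lemma linear_extension_exists (T : finType) (e : rel T) :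
  acyclic e -> exists l, linear_extension e l.
Proof.
move=> acyc; pose leh : rel T := relpre (fun x => #|connect e x|) leq.
have leh_tot : total leh by move=> x y; exact: leq_total.
have leh_tr : transitive leh by move=> x y z; exact: leq_trans.
have leh_refl : reflexive leh by move=> x; exact: leqnn.
exists (sort leh (enum T)); split.
  by split=> [|x]; rewrite ?sort_uniq ?enum_uniq // mem_sort mem_enum.
move=> x y exy; rewrite ltnNge; apply/negP => le_xy.
have := sorted_leq_index leh_tr leh_refl (sort_sorted leh_tot (enum T)).
move=> /(_ x y); rewrite !mem_sort !mem_enum => /(_ isT isT le_xy).
apply/negP; rewrite /= -ltnNge; apply: proper_card; apply/properP; split.
  by apply/subsetP => z; apply: connect_trans; exact: connect1.
exists x; first exact: connect0.
apply/negP => /connectP[p pth lst].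
suff /acyc : cycle e (y :: p) by [].
by rewrite /= rcons_path pth -lst.
Qed.

Lemma reverse_linear_extension_exists (T : finType) (e : rel T) :
  acyclic e -> exists l, reverse_linear_extension e l.
Proof.
move=> acyc; have acyc' : acyclic (fun x y => e y x).
  move=> c; rewrite -rev_cycle => /acyc /(congr1 size).
  by rewrite size_rev => /size0nil.
have [l [enl ltl]] := linear_extension_exists acyc'.
by exists l; split=> // x y /ltl.
Qed.

Section MopLattice.

Variables (T : finType) (e : rel T).
Implicit Types (X Y : {set T}) (p q r : mop e).

Definition rperp X : {set T} := [set y | (y \notin X) && no_edge e X [set y]].
Definition lperp Y : {set T} := [set x | (x \notin Y) && no_edge e [set x] Y].

Lemma orthogonal_pairP X Y :
  reflect (forall x y, x \in X -> y \in Y -> (x != y) && ~~ e x y)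
          (orthogonal_pair e X Y).
Proof.
apply: (iffP andP) => [[dXY /forall_inP nXY] x y xX yY|H].
  have /forall_inP-> // := nXY x xX; rewrite andbT.
  by apply: contraTneq yY => <-; rewrite (disjointFr dXY).
split; last first.
  by apply/forall_inP => x xX; apply/forall_inP => y yY; case/andP: (H x y xX yY).
rewrite disjoints_subset; apply/subsetP => x xX; rewrite inE.
by apply/negP => xY; have := H x x xX xY; rewrite eqxx.
Qed.

Lemma orthogonal_rperp X Y : orthogonal_pair e X Y = (Y \subset rperp X).
Proof.
apply/orthogonal_pairP/subsetP => [H y yY|H x y xX yY].
  rewrite inE; apply/andP; split.
    by apply/negP => yX; have := H y y yX yY; rewrite eqxx.
  apply/forall_inP => x xX; apply/forall_inP => z; rewrite inE => /eqP->.
  by case/andP: (H x y xX yY).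
have := H y yY; rewrite inE => /andP[yX /forall_inP/(_ x xX)/forall_inP nxy].
by rewrite nxy ?set11 // andbT; apply: contraNneq yX => <-.
Qed.

Lemma orthogonal_lperp X Y : orthogonal_pair e X Y = (X \subset lperp Y).
Proof.
apply/orthogonal_pairP/subsetP => [H x xX|H x y xX yY].
  rewrite inE; apply/andP; split.
    by apply/negP => xY; have := H x x xX xY; rewrite eqxx.
  apply/forall_inP => z; rewrite inE => /eqP->; apply/forall_inP => y yY.
  by case/andP: (H x y xX yY).
have := H x xX; rewrite inE => /andP[xY /forall_inP/(_ x (set11 x))/forall_inP nxy].
by rewrite nxy // andbT; apply: contraNneq xY => ->.
Qed.

Lemma perp_galois X Y : (Y \subset rperp X) = (X \subset lperp Y).
Proof. by rewrite -orthogonal_rperp orthogonal_lperp. Qed.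

Lemma is_mopE X Y : is_mop e X Y = (X == lperp Y) && (Y == rperp X).
Proof.
apply/andP/andP => -[].
  move=> /maxsetP[XY maxX] /maxsetP[_ maxY]; split; apply/eqP/esym.
    by apply: maxX; rewrite ?orthogonal_lperp // -orthogonal_lperp.
  by apply: maxY; rewrite ?orthogonal_rperp // -orthogonal_rperp.
move=> /eqP EX /eqP EY; split; apply/maxsetP; split.
- by rewrite orthogonal_lperp -EX.
- by move=> X'; rewrite orthogonal_lperp -EX => sX' sX; apply/eqP; rewrite eqEsubset sX'.
- by rewrite orthogonal_rperp -EY.
- by move=> Y'; rewrite orthogonal_rperp -EY => sY' sY; apply/eqP; rewrite eqEsubset sY'.
Qed.

Lemma mop_lperp p : (mop_val p).1 = lperp (mop_val p).2.
Proof. by case: p => p /=; rewrite is_mopE => /andP[/eqP]. Qed.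

Lemma mop_rperp p : (mop_val p).2 = rperp (mop_val p).1.
Proof. by case: p => p /=; rewrite is_mopE => /andP[_ /eqP]. Qed.

Lemma rperpK X : rperp (lperp (rperp X)) = rperp X.
Proof.
apply/eqP; rewrite eqEsubset perp_galois.
have sX : X \subset lperp (rperp X) by rewrite -perp_galois.
rewrite (subset_trans sX) ?perp_galois //=.
by rewrite -perp_galois.
Qed.

Lemma lperpK Y : lperp (rperp (lperp Y)) = lperp Y.
Proof.
apply/eqP; rewrite eqEsubset -[X in _ && X]perp_galois subxx andbT.
have sY : Y \subset rperp (lperp Y) by rewrite perp_galois.
by rewrite -perp_galois (subset_trans sY) // perp_galois.
Qed.

Lemma mop_of_left_subproof X : is_mop e (lperp (rperp X)) (rperp X).
Proof. by rewrite is_mopE rperpK !eqxx. Qed.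

Lemma mop_of_right_subproof Y : is_mop e (lperp Y) (rperp (lperp Y)).
Proof. by rewrite is_mopE lperpK !eqxx. Qed.

(* The least mop whose first component contains X, and the greatest mop whose
   second component contains Y. *)
Definition mop_of_left X : mop e :=
  @Mop T e (lperp (rperp X), rperp X) (mop_of_left_subproof X).
Definition mop_of_right Y : mop e :=
  @Mop T e (lperp Y, rperp (lperp Y)) (mop_of_right_subproof Y).

Definition mop_le : rel (mop e) := fun p q =>
  (mop_val p).1 \subset (mop_val q).1.

Lemma mop_leE p q : mop_le p q = ((mop_val q).2 \subset (mop_val p).2).
Proof. by rewrite /mop_le (mop_lperp q) -perp_galois -mop_rperp. Qed.

Lemma mop_le_refl : reflexive mop_le.
Proof. by move=> p; rewrite /mop_le. Qed.

Lemma mop_le_anti : antisymmetric mop_le.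
Proof.
move=> p q /andP[pq qp]; apply: val_inj.
have E : (mop_val p).1 = (mop_val q).1 by apply/eqP; rewrite eqEsubset; apply/andP.
by rewrite /= [mop_val p]surjective_pairing [mop_val q]surjective_pairing
           !mop_rperp E.
Qed.

Lemma mop_le_trans : transitive mop_le.
Proof. by move=> q p r; exact: subset_trans. Qed.

Fact mop_display : Order.disp_t. Proof. exact: Order.Disp tt tt. Qed.

HB.instance Definition _ :=
  Order.Le_isPOrder.Build mop_display (mop e)
    mop_le_refl mop_le_anti mop_le_trans.

Definition mop_meet p q : mop e :=
  mop_of_right ((mop_val p).2 :|: (mop_val q).2).
Definition mop_join p q : mop e :=
  mop_of_left ((mop_val p).1 :|: (mop_val q).1).

Lemma mop_le_meet p q r : (p <= mop_meet q r)%O = (p <= q)%O && (p <= r)%O.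
Proof.
rewrite /Order.le /= {1}/mop_le /= -perp_galois -mop_rperp subUset.
by rewrite -!mop_leE.
Qed.

Lemma mop_join_le p q r : (mop_join p q <= r)%O = (p <= r)%O && (q <= r)%O.
Proof.
rewrite /Order.le /= {1}mop_leE /= perp_galois -mop_lperp subUset.
by [].
Qed.

HB.instance Definition _ :=
  Order.POrder_isMeetSemilattice.Build mop_display (mop e) mop_le_meet.
HB.instance Definition _ :=
  Order.POrder_isJoinSemilattice.Build mop_display (mop e) mop_join_le.

Lemma mop_bottom_le p : (mop_of_left set0 <= p)%O.
Proof. by rewrite /Order.le /= mop_leE /= perp_galois sub0set. Qed.

Lemma mop_le_top p : (p <= mop_of_right set0)%O.
Proof. by rewrite /Order.le /= /mop_le /= -perp_galois sub0set. Qed.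

HB.instance Definition _ :=
  Order.hasBottom.Build mop_display (mop e) mop_bottom_le.
HB.instance Definition _ :=
  Order.hasTop.Build mop_display (mop e) mop_le_top.

End MopLattice.

Section Trim.

Local Open Scope order_scope.

Variables (d : Order.disp_t) (L : finTBLatticeType d).
Implicit Types (x y z : L) (C : {set L}).

Definition is_chain C : bool := [forall x in C, forall y in C, x >=< y].

(* The chain x_0 < ... < x_r has r + 1 elements and length r. *)
Definition longest_chain_length : nat :=
  \max_(C : {set L} | is_chain C) #|C|.-1.

Definition join_irreducible x : bool :=
  (x != \bot) && [forall y, forall z, (x == y `|` z) ==> (x == y) || (x == z)].

Definition meet_irreducible x : bool :=
  (x != \top) && [forall y, forall z, (x == y `&` z) ==> (x == y) || (x == z)].

Definition extremal : Prop :=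
  longest_chain_length = #|join_irreducible| /\
  longest_chain_length = #|meet_irreducible|.

Definition left_modular x : Prop :=
  forall y z, y <= z -> (y `|` x) `&` z = y `|` (x `&` z).

Definition left_modular_lattice : Prop :=
  exists C, maxset is_chain C /\ forall x, x \in C -> left_modular x.

Definition trim : Prop := extremal /\ left_modular_lattice.

End Trim.

Arguments trim {d} L.
Arguments top_le {T} e l l'.

Definition poset_iso (d : Order.disp_t) (P : porderType d)
    (Q : Type) (leQ : rel Q) : Prop :=
  exists f : P -> Q, bijective f /\ forall x y, (x <= y)%O = leQ (f x) (f y).

(* Main.v *)
Require Import Defs.
From HB Require Import structures.
From mathcomp Require Import all_boot all_order.

Set Implicit Arguments.
Unset Strict Implicit.
Unset Printing Implicit Defensive.

Import Order.TTheory.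

(** The lattice of maximal orthogonal pairs (mops) is compared with the tops
    through edge labels. For a cover p < q of mops (X, Y) < (X', Y'), the overlap
    X' :&: Y turns out to be a single vertex, the label of the cover; the
    isomorphism sends a mop to the set D of labels of its lower covers together
    with the set U of labels of its upper covers, and a cover labelled g becomes
    the flip at g.

    Left modularity enters once, to rank the vertices. If c = (X, Y) is left
    modular then Y is the complement of X, and a maximal chain of such elements
    separates the vertices, since otherwise modularity would fail on two
    consecutive initial segments of a linear extension (chain_rank_inj). The chain therefore lists the
    vertices in a linear order that decreases along edges, and its members are
    the initial segments S of that order (chain_rank_modular). Left modularity of
    S says that if B /\ S <= A <= B then (A \/ S) /\ B = A. Reversing all edges
    exchanges the two components of mops, so every fact about lower labels has a
    twin for upper labels (chain_rank_modular_converse).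

    From such a ranking:
    - overlaps of covers are singletons (cover_overlap): if g is the vertex of
      X' outside X of least rank, the segments just below and just up to g confine
      X' :&: Y to g;
    - every vertex of X that is not in D receives an edge from D, and D generates
      the mop (lower_labels_dominate, rperp_lower_labels), because each proper
      lower bound of a mop lies below one of its lower covers;
    - D is independent (lower_labels_independent): an edge inside D with source of
      greatest rank would produce a third label of even greater rank with an edge
      into D.

    A pair (D, U) is tight exactly when D and U are independent and orthogonal
    and every other vertex has an edge from D or to U (tight_dominated,
    dominated_tight), so labels form a top. Conversely, an independent set D
    generates a mop whose lower labels are D, and D determines U, which makes the
    label map bijective.

    For the order, let q be the upper cover of p labelled g. Two sets that are
    independent and dominate each other along edges agree wherever no edge leaves
    the region of comparison (dominating_agree). Applied to the labels of p and
    q this shows that D is unchanged off the vertices below g and U off the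
    vertices above g, and there is only one top with these traces that moves g
    from U to D, namely the flip (flip_eq). So covers and upward flips correspond,
    and both orders are the closures of these relations. *)

(** * Orthogonal complements *)

Section Perp.

Variables (T : finType) (e : rel T).
Implicit Types (A B D U : {set T}) (g k x y : T).

(** Reversing the edges exchanges the two components of a mop, and with them lower
    and upper covers. *)
Definition converse : rel T := fun x y => e y x.

Lemma no_edgeP A B :
  reflect (forall x y, x \in A -> y \in B -> ~~ e x y) (no_edge e A B).
Proof.
apply: (iffP forall_inP) => [H x y xA yB|H x xA].
  exact: (forall_inP (H x xA)).
by apply/forall_inP => y; apply: H.
Qed.

Lemma rperpP A y :
  reflect (forall x, x \in A -> (x != y) && ~~ e x y) (y \in rperp e A).
Proof.
rewrite -sub1set -orthogonal_rperp.
apply: (iffP (orthogonal_pairP _ _ _)) => H x; last by move=> z xA /set1P->; apply: H.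
by move=> xA; apply: H => //; apply: set11.
Qed.

Lemma lperpP B x :
  reflect (forall y, y \in B -> (x != y) && ~~ e x y) (x \in lperp e B).
Proof.
rewrite -sub1set -orthogonal_lperp.
apply: (iffP (orthogonal_pairP _ _ _)) => H y; last by move=> z /set1P->; apply: H.
by move=> yB; apply: H => //; apply: set11.
Qed.

Lemma in_lperp1 g x : (x \in lperp e [set g]) = (x != g) && ~~ e x g.
Proof.
by apply/lperpP/idP => [->|H y /set1P->] //; apply: set11.
Qed.

Lemma in_rperp1 g y : (y \in rperp e [set g]) = (g != y) && ~~ e g y.
Proof.
by apply/rperpP/idP => [->|H x /set1P->] //; apply: set11.
Qed.

Lemma notin_rperp A y :
  y \notin rperp e A -> y \in A \/ exists2 x, x \in A & e x y.
Proof.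
rewrite inE negb_and negbK => /orP[|H]; first by left.
right; case/forall_inPn: H => x xA /forall_inPn[z /set1P->].
by rewrite negbK; exists x.
Qed.

Lemma rperpS A B : A \subset B -> rperp e B \subset rperp e A.
Proof.
move=> /subsetP sAB; apply/subsetP => y /rperpP H.
by apply/rperpP => x /sAB; apply: H.
Qed.

Lemma lperpS A B : A \subset B -> lperp e B \subset lperp e A.
Proof.
move=> /subsetP sAB; apply/subsetP => y /lperpP H.
by apply/lperpP => x /sAB; apply: H.
Qed.

Lemma rperpU A B : rperp e (A :|: B) = rperp e A :&: rperp e B.
Proof.
apply/setP => y; rewrite in_setI; apply/rperpP/andP => [H|[/rperpP HA /rperpP HB] x].
  by split; apply/rperpP => x xA; apply: H; rewrite inE xA ?orbT.
by case/setUP; [apply: HA | apply: HB].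
Qed.

Lemma rperp_disjoint A x : x \in A -> x \in rperp e A -> False.
Proof. by move=> xA /rperpP/(_ x xA); rewrite eqxx. Qed.

(** The closed sets are the first components of mops; meets are intersections. *)
Definition closed A := lperp e (rperp e A) == A.

Lemma sub_closure A : A \subset lperp e (rperp e A).
Proof. by rewrite -perp_galois. Qed.

Lemma closed_lperp B : closed (lperp e B).
Proof. by rewrite /closed lperpK. Qed.

Lemma closure_sub A B :
  closed B -> A \subset B -> lperp e (rperp e A) \subset B.
Proof. by move=> /eqP clB sAB; rewrite -clB lperpS ?rperpS. Qed.

Lemma closedI A B : closed A -> closed B -> closed (A :&: B).
Proof.
move=> cA cB; rewrite /closed eqEsubset sub_closure andbT subsetI.
by rewrite !closure_sub ?subsetIl ?subsetIr.
Qed.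

End Perp.

Section Converse.

Variables (T : finType) (e : rel T).
Implicit Types (A B : {set T}) (y : T).

Lemma no_edge_converse A B : no_edge (converse e) A B = no_edge e B A.
Proof. by apply/no_edgeP/no_edgeP => H x y xA yB; apply: H. Qed.

Lemma rperp_converse A : rperp (converse e) A = lperp e A.
Proof. by apply/setP => y; rewrite !inE no_edge_converse. Qed.

Lemma lperp_converse A : lperp (converse e) A = rperp e A.
Proof. by apply/setP => y; rewrite !inE no_edge_converse. Qed.

Lemma independent_converse A : independent (converse e) A = independent e A.
Proof. exact: no_edge_converse. Qed.

End Converse.

(** * Lower labels *)

Section Ranking.

Variables (T : finType) (e : rel T).
Implicit Types (A B D U : {set T}) (g k x y : T).

(** The last clause is left modularity of the initial segment S = [set k | r k < i],
    in the case B /\ S <= A <= B. As r decreases along edges, S is paired with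
    its complement, which makes lperp (rperp A :&: ~: S) the join of A and S. *)
Definition modular_ranking (r : T -> nat) : Prop :=
  [/\ injective r, forall x y, e x y -> r y < r x
    & forall A B i, closed e A -> closed e B -> A \subset B ->
        B :&: [set k | r k < i] \subset A ->
        B :&: lperp e (rperp e A :&: [set k | i <= r k]) \subset A].

(** If B is closed then B :&: lperp [set g] is the first component of the greatest
    mop below B having g on its other side. With a modular ranking, the overlap of
    that mop with B is g alone exactly when B covers it, and every lower cover
    with label g arises so. *)
Definition lower_labels B : {set T} :=
  [set g in B | B :&: rperp e (B :&: lperp e [set g]) == [set g]].

Variable r : T -> nat.
Hypothesis ranking : modular_ranking r.

Let r_inj : injective r. Proof. by case: ranking. Qed.
Let r_edge x y : e x y -> r y < r x. Proof. by case: ranking => _ + _; apply. Qed.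
Let r_modular A B i : closed e A -> closed e B -> A \subset B ->
        B :&: [set k | r k < i] \subset A ->
        B :&: lperp e (rperp e A :&: [set k | i <= r k]) \subset A.
Proof. by case: ranking => _ _; apply. Qed.

(** Let g be the vertex of B outside A of least rank. The segment of ranks below g
    meets B inside A, so by modularity its join with A is not above B, while its
    join with A after adding g is. The first fact puts g in rperp A, and the
    second leaves no room in the overlap for ranks above that of g. *)
Lemma cover_overlap A B :
  closed e A -> closed e B -> A \proper B ->
  (forall Z, closed e Z -> A \subset Z -> Z \proper B -> Z = A) ->
  exists g, B :&: rperp e A = [set g].
Proof.
move=> clA clB /andP[sAB nBA] cover.
have [g0 g0B g0A] : exists2 g, g \in B & g \notin A.
  by case/subsetPn: nBA => g; exists g.
pose P := [pred k | (k \in B) && (k \notin A)].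
have [g /andP[gB gA] gmin] := @arg_minnP _ g0 P r (introT andP (conj g0B g0A)).
exists g.
have ltr k : k \in B -> r k < r g -> k \in A.
  move=> kB; apply: contraTT => kA; rewrite -leqNgt; apply: gmin.
  by rewrite /P /= kB.
have ltI : B :&: [set k | r k < r g] \subset A.
  by apply/subsetP => k /setIP[kB]; rewrite inE; apply: ltr.
have noLow := r_modular clA clB sAB ltI.
pose Z := B :&: lperp e (rperp e A :&: [set k | r g < r k]).
have sAZ : A \subset Z.
  rewrite subsetI sAB /=; apply: subset_trans (sub_closure e A) _.
  by rewrite lperpS // subsetIl.
have gZ : g \in Z.
  rewrite in_setI gB; apply/lperpP => y /setIP[_]; rewrite inE => lt_gy.
  apply/andP; split; first by apply: contraTneq lt_gy => ->; rewrite ltnn.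
  by apply/negP => /r_edge; rewrite ltnNge ltnW.
have ZB : Z = B.
  apply: contraTeq gA => nZB; rewrite negbK -(cover Z) //.
    by apply: closedI => //; exact: closed_lperp.
  by rewrite properEneq nZB subsetIl.
have high k : k \in B -> k \in rperp e A -> r k <= r g.
  move=> kB kA; rewrite leqNgt; apply/negP => lt_gk.
  have : k \in Z by rewrite ZB.
  case/setIP => _ /lperpP /(_ k); rewrite in_setI kA inE lt_gk eqxx.
  by move=> /(_ isT).
have gY : g \in rperp e A.
  apply: contraNT gA => gY; apply: (subsetP noLow); rewrite in_setI gB.
  rewrite -ZB in gB; case/setIP: gB => _ /lperpP gZ'.
  apply/lperpP => y /setIP[yA]; rewrite inE leq_eqVlt => /orP[/eqP|lt_gy].
    by move/r_inj => gy; rewrite gy yA in gY.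
  by apply: gZ'; rewrite in_setI yA inE.
apply/setP => k; rewrite in_setI in_set1; apply/andP/eqP => [[kB kA]|->] //.
apply: r_inj; apply/eqP; rewrite eqn_leq high //= leqNgt.
by apply/negP => lt_kg; exact: rperp_disjoint (ltr k kB lt_kg) kA.
Qed.

(** Between A and B there is a lower cover of B, and its label will do. *)
Lemma lower_label_exists A B :
  closed e A -> closed e B -> A \proper B ->
  exists2 g, g \in lower_labels B & g \in rperp e A.
Proof.
move=> clA clB pAB.
pose P Z := [&& closed e Z, A \subset Z & Z \proper B].
have PA : P A by rewrite /P clA subxx.
have [Z /maxsetP[/and3P[clZ sAZ pZB] maxZ] _] := maxset_exists PA.
have [|g Eg] := cover_overlap clZ clB pZB.
  move=> W clW sZW pWB; apply: maxZ => //; rewrite /P clW pWB.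
  by rewrite (subset_trans sAZ).
have /setIP[gB gZ] : g \in B :&: rperp e Z by rewrite Eg set11.
have gA : g \in rperp e A by apply: (subsetP (rperpS e sAZ)).
exists g => //; rewrite inE gB /=.
suff -> : B :&: lperp e [set g] = Z by apply/eqP.
apply: maxZ; last first.
  by rewrite subsetI (proper_sub pZB) -perp_galois sub1set.
rewrite /P closedI ?closed_lperp //= subsetI -perp_galois sub1set gA.
rewrite (proper_sub pAB) /= properE subsetIl; apply/subsetPn; exists g => //.
by rewrite in_setI in_lperp1 eqxx andbF.
Qed.

Lemma lower_labels_sub B : lower_labels B \subset B.
Proof. by apply/subsetP => g; rewrite inE => /andP[]. Qed.

(** The meet B :&: lperp [set k] lies below a lower cover of B. The label g of that
    cover is outside the meet although it belongs to B, so g = k or g -> k. *)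
Lemma lower_labels_dominate B k : closed e B ->
  k \in B -> k \notin lower_labels B -> exists2 g, g \in lower_labels B & e g k.
Proof.
move=> clB kB kD.
have [||g gD gA] := @lower_label_exists (B :&: lperp e [set k]) B _ clB.
- by rewrite closedI ?closed_lperp.
- rewrite properE subsetIl; apply/subsetPn; exists k => //.
  by rewrite in_setI in_lperp1 eqxx andbF.
exists g => //; apply: contraTT gA => ngk; apply/negP; apply: rperp_disjoint.
rewrite in_setI (subsetP (lower_labels_sub B)) // in_lperp1 ngk andbT.
by apply: contraNneq kD => <-.
Qed.

(** Labels of lower covers are lost on passing to those covers, so the mop generated
    by the labels of B lies below none of the lower covers of B. *)
Lemma rperp_lower_labels B : closed e B -> rperp e (lower_labels B) = rperp e B.
Proof.
move=> clB; rewrite -rperpK; congr rperp; apply/eqP.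
rewrite eqEsubset closure_sub ?lower_labels_sub //=; apply/negPn/negP => nB.
have [||g gD] := @lower_label_exists (lperp e (rperp e (lower_labels B))) B _ clB.
- exact: closed_lperp.
- by rewrite properE closure_sub ?lower_labels_sub.
by rewrite rperpK; apply: rperp_disjoint.
Qed.

(** Take an edge g' -> g between labels of B with g' of greatest rank. Let w be the
    meet of the two covers labelled g and g', and let v be the meet of B with the
    join of w and the segment of ranks up to that of g'. By modularity v is not
    all of B, so a lower cover of B with some label h lies above v. Then h has
    greater rank than g', yet h is outside w, which gives an edge from h to g or
    to g': this contradicts the choice of g'. *)
Lemma lower_labels_independent B : closed e B -> independent e (lower_labels B).
Proof.
move=> clB; apply/no_edgeP.
(* n - r g' measures how far the source of the edge is from the greatest rank *)
suff H n g' g : (forall k, r k <= n) -> g' \in lower_labels B ->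
                g \in lower_labels B -> ~~ e g' g.
  by move=> g' g; apply: (H (\max_k r k)) => k; apply: leq_bigmax.
move=> bound; have [m] := ubnP (n - r g').
elim: m => // m IH in g g' *; rewrite ltnS => le_m g'D gD; apply/negP => g'g.
have gB := subsetP (lower_labels_sub B) g gD.
have g'B := subsetP (lower_labels_sub B) g' g'D.
pose z := B :&: lperp e [set g]; pose w := z :&: lperp e [set g'].
have clz : closed e z by rewrite closedI ?closed_lperp.
have clw : closed e w by rewrite closedI ?closed_lperp.
have swz : w \subset z by apply: subsetIl.
have szB : z \subset B by apply: subsetIl.
pose v := B :&: lperp e (rperp e w :&: [set k | r g' < r k]).
have clv : closed e v by rewrite closedI ?closed_lperp.
have pvB : v \proper B.
  rewrite properEneq subsetIl andbT; apply/eqP => Ev.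
  (* if v = B then modularity gives w = z, and g' joins g in the overlap at g *)
  have swz' : z :&: [set k | r k < (r g').+1] \subset w.
    apply/subsetP => k /setIP[kz]; rewrite inE ltnS in_setI kz in_lperp1 /= => le_k.
    apply/andP; split; last by apply/negP => /r_edge; rewrite ltnNge le_k.
    apply: contraTneq kz => ->; by rewrite in_setI in_lperp1 g'g !andbF.
  have := r_modular clw clz swz swz'; rewrite -/v.
  have -> : z :&: lperp e (rperp e w :&: [set k | r g' < r k]) = z.
    by apply/setIidPl; apply: subset_trans szB _; rewrite -{1}Ev subsetIr.
  move=> szw; move: gD; rewrite inE gB /= -/z => /eqP Eg.
  have : g' \in B :&: rperp e z.
    rewrite in_setI g'B /=; apply/rperpP => x /(subsetP szw) /setIP[_].
    by rewrite in_lperp1.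
  rewrite Eg => /set1P Egg; move: (r_edge g'g); by rewrite Egg ltnn.
have [h hD hv] := lower_label_exists clv clB pvB.
have hB := subsetP (lower_labels_sub B) h hD.
have lt_h : r g' < r h.
  rewrite ltnNge; apply/negP => le_h; apply: (rperp_disjoint _ hv).
  rewrite in_setI hB /=; apply/lperpP => y /setIP[_]; rewrite inE => lt_y.
  apply/andP; split; first by apply: contraTneq lt_y => <-; rewrite -leqNgt.
  by apply/negP => /r_edge; rewrite ltnNge (leq_trans le_h) // ltnW.
have hm : n - r h < m.
  apply: leq_trans le_m; apply: ltn_sub2l => //; exact: leq_trans lt_h (bound h).
have hw : h \notin w.
  apply/negP => hw; apply: (rperp_disjoint _ hv); rewrite in_setI hB /=.
  have := subsetP (sub_closure e w) h hw; apply: subsetP.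
  by rewrite lperpS // subsetIl.
have [hg hg'] : h != g /\ h != g'.
  split; apply: contraTneq lt_h => ->; rewrite -leqNgt // ltnW //; exact: r_edge.
case/negP: hw; rewrite !in_setI !in_lperp1 hB hg hg' /=.
by rewrite (IH g h) ?(IH g' h).
Qed.

(** Every vertex of the closure outside D receives an edge from D. Hence the members
    of D are labels, and another label would contradict independence. *)
Lemma lower_labels_closure D : independent e D ->
  lower_labels (lperp e (rperp e D)) = D.
Proof.
move=> /no_edgeP indD; set B := lperp _ _.
have clB : closed e B by exact: closed_lperp.
have sDB : D \subset B by exact: sub_closure.
have dom k : k \in B -> k \notin D -> exists2 x, x \in D & e x k.
  move=> kB kD; case: (@notin_rperp _ e D k) => [|/(negP kD)|] //.
  by apply/negP => kY; apply: (@rperp_disjoint _ e B k); rewrite ?rperpK.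
have sD : D \subset lower_labels B.
  apply/subsetP => g gD; have gB := subsetP sDB g gD.
  rewrite inE gB; apply/eqP/setP => k; rewrite in_setI in_set1.
  apply/andP/eqP => [[kB /rperpP Hk]|->]; last first.
    split=> //; apply/rperpP => x /setIP[_]; by rewrite in_lperp1.
  apply/eqP/negPn/negP => kg.
  have e_kg : e k g.
    apply: contraT => nkg; suff: k \in B :&: lperp e [set g] by move=> /Hk; rewrite eqxx.
    by rewrite in_setI kB in_lperp1 kg.
  have kD : k \notin D by apply: contraTN e_kg => kD; exact: indD.
  have [x xD xk] := dom k kB kD.
  have /andP[_ /negP[]] // : (x != k) && ~~ e x k.
  apply: Hk; rewrite in_setI (subsetP sDB) // in_lperp1 (indD x g) // andbT.
  by apply: contraTneq xk => ->; apply/negP => /r_edge; rewrite ltnNge ltnW ?r_edge.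
apply/eqP; rewrite eqEsubset sD andbT; apply/subsetP => k kL.
apply: contraT => kD.
have [x xD] := dom k (subsetP (lower_labels_sub B) k kL) kD.
apply: contraLR => _; have /no_edgeP := lower_labels_independent clB.
by apply=> //; apply: (subsetP sD).
Qed.

End Ranking.

(** * A ranking of the vertices from a left modular chain *)

Section LeftModularChain.

Variables (T : finType) (e : rel T) (l : seq T).
Hypothesis lin_l : linear_extension e l.
Implicit Types (A B : {set T}) (k g x y : T) (p q c : mop e) (C : {set mop e}).

Local Notation Xp p := (mop_val p).1.
Local Notation Yp p := (mop_val p).2.

Lemma mop_meet_left p q : Xp (p `&` q)%O = Xp p :&: Xp q.
Proof.
rewrite (mop_lperp p) (mop_lperp q) -!rperp_converse -rperpU rperp_converse //.
Qed.

Lemma mop_join_right p q : Yp (p `|` q)%O = Yp p :&: Yp q.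
Proof. by rewrite (mop_rperp p) (mop_rperp q) -rperpU. Qed.

Lemma mop_join_left p q : Xp (p `|` q)%O = lperp e (Yp p :&: Yp q).
Proof. by rewrite mop_lperp mop_join_right. Qed.

Lemma mop_meet_right p q : Yp (p `&` q)%O = rperp e (Xp p :&: Xp q).
Proof. by rewrite mop_rperp mop_meet_left. Qed.

(** Left modularity of c when the meet of c and q is below p; left_modular_join is
    the dual case. *)
Lemma left_modular_meet c p q : left_modular c -> Xp p \subset Xp q ->
  Xp q :&: Xp c \subset Xp p ->
  Xp q :&: lperp e (Yp p :&: Yp c) \subset Xp p.
Proof.
move=> modc le_pq cqp; have := modc p q le_pq.
have -> : (p `|` (c `&` q) = p)%O.
  apply/join_idPl; rewrite /Order.le /= /mop_le.
  by rewrite mop_meet_left setIC.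
by move=> E; rewrite setIC -mop_join_left -mop_meet_left E.
Qed.

Lemma left_modular_join c p q : left_modular c -> Xp p \subset Xp q ->
  Yp p :&: Yp c \subset Yp q ->
  Yp p :&: rperp e (Xp q :&: Xp c) \subset Yp q.
Proof.
move=> modc le_pq cqp; have := modc p q le_pq.
have -> : ((p `|` c) `&` q = q)%O.
  apply/meet_idPr; rewrite /Order.le /= mop_leE.
  by rewrite mop_join_right.
by move=> E; rewrite [X in rperp e X]setIC -mop_meet_right -mop_join_right -E.
Qed.

Lemma no_edge_perp A : no_edge e A (~: A) ->
  rperp e A = ~: A /\ lperp e (~: A) = A.
Proof.
move=> /no_edgeP nA; split; apply/setP => k.
  apply/rperpP/idP => [H|]; rewrite inE.
    by apply/negP => kA; have := H k kA; rewrite eqxx.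
  move=> kA x xA; rewrite nA ?inE // andbT.
  by apply: contraNneq kA => <-.
apply/lperpP/idP => [H|kA y].
  by apply/negPn/negP => kA; have := H k; rewrite inE eqxx => /(_ kA).
rewrite inE => yA; rewrite nA ?inE // andbT.
by apply: contraNneq yA => <-.
Qed.

(** Initial segments of a linear extension have no outgoing edges, so they form mops
    with their complements. The segment stops before or after k. *)
Lemma linear_extension_mop k (strict : bool) :
  let A := [set h | index h l + strict <= index k l] in
  Xp (mop_of_left e A) = A /\ Yp (mop_of_left e A) = ~: A.
Proof.
move=> A; have [|H1 H2] := @no_edge_perp A.
  apply/no_edgeP => x y; rewrite !inE => xA; apply: contra => exy.
  apply: leq_trans xA; rewrite leq_add2r ltnW //; by case: lin_l => _; apply.
by rewrite /= H1 H2.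
Qed.

(** Left modularity for the consecutive initial segments ending before and after k:
    the join of c with the shorter one cannot acquire k. *)
Lemma left_modular_prefix c k : left_modular c -> k \notin Xp c ->
  k \notin lperp e (~: [set h | index h l < index k l] :&: Yp c).
Proof.
move=> modc kc; set A := [set h | _].
have [XA YA] := linear_extension_mop k true.
have [XB YB] := linear_extension_mop k false.
have EA : [set h | index h l + true <= index k l] = A.
  by apply/setP => h; rewrite !inE addn1.
have mem_l h : h \in l by case: lin_l => -[].
have uniq_l : uniq l by case: lin_l => -[].
rewrite EA in XA YA; set p := mop_of_left e A in XA YA.
set B := [set h | _] in XB YB; set q := mop_of_left e B in XB YB.
have := @left_modular_meet c p q modc; rewrite XA XB YA => H.
apply/negP => kL; have : k \in A.
  apply: (subsetP (H _ _)).
  - by apply/subsetP => h; rewrite !inE addn0; exact: ltnW.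
  - apply/subsetP => h; rewrite !inE addn0 leq_eqVlt => /andP[/orP[/eqP|//]].
    move=> Ehk; have -> : h = k by rewrite -[h](nth_index k (mem_l h)) Ehk nth_index.
    by rewrite (negPf kc).
  - by rewrite in_setI kL inE addn0 leqnn.
by rewrite inE ltnn.
Qed.

(** A vertex k missing from both components would, by left_modular_prefix, have an
    edge to a vertex which the linear extension places after k. *)
Lemma left_modular_right c : left_modular c -> Yp c = ~: Xp c.
Proof.
move=> modc; apply/setP => k; rewrite in_setC; apply/idP/idP => [kY|kX].
  apply/negP => kX; rewrite mop_rperp in kY; exact: rperp_disjoint kX kY.
have := left_modular_prefix modc kX; rewrite -rperp_converse.
case/notin_rperp => [/setIP[]//|[h /setIP[hA _]]].
rewrite /converse => ekh; move: hA; rewrite !inE.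
by case: lin_l => _ /(_ _ _ ekh) ->.
Qed.

Variable C : {set mop e}.
Hypothesis maxC : maxset (@is_chain _ (mop e)) C.
Hypothesis modC : forall c, c \in C -> left_modular c.

Lemma chain_separated c d k :
  c \in C -> d \in C -> k \in Xp c -> k \notin Xp d -> Xp d \subset Xp c.
Proof.
move=> cC dC kc kd; have [/forall_inP/(_ c cC)/forall_inP/(_ d dC) + _] := maxsetP maxC.
by rewrite /Order.comparable => /orP[/subsetP/(_ k kc)|//]; rewrite (negPf kd).
Qed.

Lemma maximal_chain_mem t :
  (forall c, c \in C -> (Xp c \subset Xp t) || (Xp t \subset Xp c)) -> t \in C.
Proof.
move=> compt; have [chC +] := maxsetP maxC.
move=> /(_ (t |: C)) <-; rewrite ?subsetUr ?setU11 //.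
have chCP c d : c \in C -> d \in C -> (c >=< d)%O.
  by move=> cC dC; apply: (forall_inP (forall_inP chC c cC)).
apply/forall_inP => c /setU1P[->|cC]; apply/forall_inP => d /setU1P[->|dC].
- by rewrite /Order.comparable lexx.
- by rewrite /Order.comparable orbC; apply: compt.
- by rewrite /Order.comparable; apply: compt.
- exact: chCP.
Qed.

Definition chain_rank k := #|[set c in C | k \notin Xp c]|.

Lemma chain_rank_lt c k k' :
  c \in C -> k \in Xp c -> k' \notin Xp c -> chain_rank k < chain_rank k'.
Proof.
move=> cC kc k'c; apply: proper_card; apply/properP; split; last first.
  by exists c; rewrite inE cC ?k'c ?kc.
apply/subsetP => d; rewrite !inE => /andP[dC kd]; rewrite dC /=.
by apply: contra kd => k'd; apply: (subsetP (chain_separated dC cC k'd k'c)).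
Qed.

Lemma least_chain_element k : exists2 c, c \in C & k \in Xp c /\
  forall d, d \in C -> k \in Xp d -> Xp c \subset Xp d.
Proof.
have topC : (\top : mop e)%O \in C.
  by apply: maximal_chain_mem => c _; apply/orP; left; exact: (lex1 c).
have ktop : k \in Xp (\top : mop e)%O.
  by apply/lperpP => y; rewrite inE.
have [c /andP[cC kc] minc] := @arg_minnP _ (\top : mop e)%O
  (fun c => (c \in C) && (k \in Xp c)) (fun c => #|Xp c|) (introT andP (conj topC ktop)).
exists c => //; split=> // d dC kd.
apply: contraT => ncd; have [h hc hd] := subsetPn ncd.
have sdc := chain_separated cC dC hc hd; case/negP: ncd.
suff -> : Xp c = Xp d by [].
by apply/eqP; rewrite eq_sym eqEcard sdc minc ?dC.
Qed.

Lemma greatest_chain_element (P : pred (mop e)) : P (\bot : mop e)%O ->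
  exists2 c, c \in C & P c /\
    forall d, d \in C -> P d -> Xp d \subset Xp c.
Proof.
move=> Pbot.
have botC : (\bot : mop e)%O \in C.
  by apply: maximal_chain_mem => c _; apply/orP; right; exact: (le0x c).
have [c /andP[cC kc] maxc] := @arg_maxnP _ (\bot : mop e)%O
  (fun c => (c \in C) && P c) (fun c => #|Xp c|) (introT andP (conj botC Pbot)).
exists c => //; split=> // d dC kd.
apply: contraT => ndc; have [h hd hc] := subsetPn ndc.
have scd := chain_separated dC cC hd hc; case/negP: ndc.
suff -> : Xp c = Xp d by [].
by apply/eqP; rewrite eqEcard scd; apply: maxc; rewrite dC.
Qed.

Lemma bot_left : Xp (\bot : mop e)%O = set0.
Proof.
have -> : Xp (\bot : mop e)%O = lperp e setT.
  by congr lperp; apply/setP => y; rewrite in_setT; apply/rperpP => x; rewrite inE.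
apply/setP => x; rewrite in_set0; apply/negP => /lperpP /(_ x).
by rewrite inE eqxx => /(_ isT).
Qed.

Lemma chain_rank_initial i :
  exists2 c, c \in C & Xp c = [set k | chain_rank k < i].
Proof.
set S := [set k | _].
have [|c cC [cS maxc]] := @greatest_chain_element (fun c => Xp c \subset S).
  by rewrite bot_left sub0set.
exists c => //; apply/eqP; rewrite eqEsubset cS /=; apply/subsetP => k kS.
have [c' c'C [kc' minc']] := least_chain_element k.
apply: (subsetP (maxc c' c'C _)) => //.
apply/subsetP => h hc'; rewrite inE in kS; rewrite inE; apply: leq_ltn_trans kS.
apply: subset_leq_card; apply/subsetP => d; rewrite !inE => /andP[dC hd].
by rewrite dC; apply: contra hd => kd; apply: (subsetP (minc' d dC kd)).
Qed.

(** Suppose that k precedes k' in l and that no member of the chain separates them.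
    Let b be the last member without k and k'. By maximality, the join t of b and
    the mop generated by k belongs to the chain, so t contains k' as well. But t
    lies below the join of b and the segment before k', which cannot acquire k'. *)
Lemma chain_rank_inj : injective chain_rank.
Proof.
suff H k k' : index k l < index k' l -> chain_rank k <> chain_rank k'.
  have mem_l h : h \in l by case: lin_l => -[].
  move=> k k' Ekk'; case: (ltngtP (index k l) (index k' l)).
  - by move=> /H.
  - by move=> /H /(_ (esym Ekk')).
  - by move=> Ei; rewrite -[k](nth_index k (mem_l k)) Ei nth_index.
move=> lt_kk' Er.
have same c : c \in C -> (k \in Xp c) = (k' \in Xp c).
  move=> cC; apply/idP/idP => H; apply: contraT => nH.
    by have := chain_rank_lt cC H nH; rewrite Er ltnn.
  by have := chain_rank_lt cC H nH; rewrite Er ltnn.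
have [c cC [kc minc]] := least_chain_element k.
have [|b bC [kb maxb]] := @greatest_chain_element (fun c => k \notin Xp c).
  by rewrite bot_left inE.
pose t := (b `|` mop_of_left e [set k])%O.
have kt : k \in Xp t.
  have : (mop_of_left e [set k] <= t)%O by apply: leUr.
  by move=> /subsetP; apply; rewrite -sub1set; apply: sub_closure.
have tC : t \in C.
  apply: maximal_chain_mem => d dC; have [kd|kd] := boolP (k \in Xp d).
    apply/orP; right; suff : (t <= d)%O by [].
    rewrite leUx; apply/andP; split.
      exact: chain_separated dC bC kd kb.
    by rewrite /Order.le /= /mop_le /= closure_sub ?sub1set // mop_lperp closed_lperp.
  apply/orP; left; apply: subset_trans (maxb d dC kd) _.
  exact: (leUl b (mop_of_left e [set k])).
have k't : k' \in Xp t by rewrite -same.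
have k'b : k' \notin Xp b by rewrite -same.
move: (left_modular_prefix (modC bC) k'b); apply/negP; rewrite negbK.
move: k't; rewrite mop_join_left; apply: subsetP; rewrite lperpS // setIC setIS //.
apply/subsetP => y; rewrite inE => yA; apply/rperpP => x /set1P->.
have [_ YA] := linear_extension_mop k' true.
have : y \in Yp (mop_of_left e [set h | index h l + true <= index k' l]).
  by rewrite YA inE; rewrite !inE in yA *; rewrite addn1.
move: y {yA}; rewrite mop_rperp.
have [-> _] := linear_extension_mop k' true.
by move=> y /rperpP; apply; rewrite inE addn1.
Qed.

Lemma chain_rank_edge x y : e x y -> chain_rank y < chain_rank x.
Proof.
move=> exy; rewrite ltn_neqAle; apply/andP; split.
  apply/eqP => /chain_rank_inj Exy; case: lin_l => _ /(_ _ _ exy).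
  by rewrite Exy ltnn.
rewrite leqNgt; apply/negP => lt_xy.
have [c cC Ec] := chain_rank_initial (chain_rank y).
have xc : x \in Xp c by rewrite Ec inE.
have yc : y \in Yp c by rewrite (left_modular_right (modC cC)) Ec !inE ltnn.
by move: yc; rewrite mop_rperp => /rperpP/(_ x xc); rewrite exy andbF.
Qed.

Lemma chain_rank_modular : modular_ranking e chain_rank.
Proof.
split; [exact: chain_rank_inj | exact: chain_rank_edge | ].
move=> A B i /eqP clA /eqP clB sAB; have [c cC Ec] := chain_rank_initial i.
have -> : [set k | i <= chain_rank k] = Yp c.
  by rewrite (left_modular_right (modC cC)) Ec; apply/setP => k; rewrite !inE leqNgt.
rewrite -Ec.
have := @left_modular_meet c (mop_of_left e A) (mop_of_left e B) (modC cC).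
by rewrite /= clA clB; apply.
Qed.

Lemma chain_rank_modular_converse :
  modular_ranking (converse e) (fun k => #|C| - chain_rank k).
Proof.
have le_rC k : chain_rank k <= #|C|.
  by apply: subset_leq_card; apply/subsetP => c; rewrite inE => /andP[].
have ltE k i : (#|C| - chain_rank k < i) = ~~ (chain_rank k < #|C|.+1 - i).
  by rewrite ltnNge leq_subRL // ltn_subRL ltnS addnC.
split.
- move=> k k' Ek; apply: chain_rank_inj.
  by rewrite -(subKn (le_rC k)) Ek subKn.
- move=> x y /chain_rank_edge lt_xy; apply: ltn_sub2l => //.
  exact: leq_trans lt_xy (le_rC y).
move=> B A i; rewrite /closed !(lperp_converse e) !(rperp_converse e).
move=> /eqP clB /eqP clA sBA.
have [c cC Ec] := chain_rank_initial (#|C|.+1 - i).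
have -> : [set k | #|C| - chain_rank k < i] = Yp c.
  by rewrite (left_modular_right (modC cC)) Ec; apply/setP => k; rewrite !inE ltE.
have -> : [set k | i <= #|C| - chain_rank k] = Xp c.
  by rewrite Ec; apply/setP => k; rewrite !inE leqNgt ltE negbK.
have := @left_modular_join c (mop_of_right e A) (mop_of_right e B) (modC cC).
rewrite /= clA clB; apply; exact: lperpS.
Qed.

End LeftModularChain.

(** * Tops *)

Section Tops.

Variables (T : finType) (e : rel T).
Implicit Types (A D U : {set T}) (g k d u x y : T).

(** A local form of tightness: U is a kernel of the graph induced on rperp D, and
    dually for D. *)
Definition dominated_pair D U : Prop :=
  [/\ independent e D, independent e U, orthogonal_pair e D U
    & forall k, k \notin D -> k \notin U ->
        (exists2 d, d \in D & e d k) \/ (exists2 u, u \in U & e k u)].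

Lemma orthogonal_indepP D U :
  reflect [/\ independent e D, independent e U & orthogonal_pair e D U]
          (orthogonal_indep e D U).
Proof. exact: and3P. Qed.

Variable r : T -> nat.
Hypothesis r_edge : forall x y, e x y -> r y < r x.

Lemma edge_irrefl x : e x x = false.
Proof. by apply/negP => /r_edge; rewrite ltnn. Qed.

Lemma connect_rank x y : connect e x y -> r y <= r x.
Proof.
move=> /connectP[p + ->]; elim: p x => //= z p IH x /andP[/r_edge lt_zx /IH].
by move=> /leq_trans; apply; exact: ltnW.
Qed.

(** A vertex k with no edge from D or to U could enter D in exchange for its
    out-neighbours there, all of which are smaller. *)
Lemma tight_dominated D U : tight e D U -> dominated_pair D U.
Proof.
case/and5P=> /orthogonal_indepP[indD indU orthDU] incD decU addD addU.
split=> // k kD kU.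
have [/exists_inP[d]|noD] := boolP [exists d in D, e d k]; first by left; exists d.
have [/exists_inP[u]|noU] := boolP [exists u in U, e k u]; first by right; exists u.
rewrite !negb_exists_in in noD noU.
move: noD noU => /forall_inP noD /forall_inP noU; exfalso.
pose A := [set d in D | e k d].
have orth : orthogonal_indep e (k |: (D :\: A)) U.
  apply/orthogonal_indepP; split=> //.
    apply/no_edgeP => x y /setU1P[->|/setDP[xD xA]] /setU1P[->|/setDP[yD yA]].
    - by rewrite edge_irrefl.
    - by move: yA; rewrite inE yD.
    - exact: noD.
    - exact: (no_edgeP _ _ _ indD).
  apply/orthogonal_pairP => x y /setU1P[->|/setDP[xD _]] yU.
    by rewrite noU // andbT; apply: contraNneq kU => ->.
  exact: (orthogonal_pairP _ _ _ orthDU).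
have [A0|nA0] := eqVneq A set0.
  by move/forall_inP: addD => /(_ k kD); rewrite A0 setD0 in orth; rewrite orth.
move: incD => /forallP/(_ A)/forallP/(_ k)/implyP; rewrite nA0 kD orth /=.
suff [-> ->] : A \subset D /\ [forall d in A, glt e d k] by move/(_ isT).
split; first by apply/subsetP => d; rewrite inE => /andP[].
apply/forall_inP => d; rewrite inE => /andP[dD ekd].
rewrite /glt /gle (connect1 ekd) andbT.
by apply: contraNneq kD => <-.
Qed.

(** An exchange inserting k in D requires that D has an edge to k whose source was
    removed, so that k is below a vertex that it should exceed; dually for U. *)
Lemma dominated_tight D U : dominated_pair D U -> tight e D U.
Proof.
move=> [indD indU orthDU dom].
have noDD := no_edgeP _ _ _ indD; have noUU := no_edgeP _ _ _ indU.
have noDU := orthogonal_pairP _ _ _ orthDU.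
apply/and5P; split; first exact/orthogonal_indepP.
- apply/forallP => A; apply/forallP => k; apply/implyP.
  case/and4P => _ _ kD /forall_inP ltA; apply/negP => /orthogonal_indepP[].
  move=> /no_edgeP indk _ /orthogonal_pairP orthk.
  have kk : k \in k |: (D :\: A) by exact: setU11.
  have kU : k \notin U by apply/negP => /(orthk k k kk); rewrite eqxx.
  case: (dom k kD kU) => -[x xDU]; last by case/andP: (orthk k x kk xDU) => _ /negPf->.
  have [xA exk|xA exk] := boolP (x \in A); last first.
    by move: exk; apply/negP; apply: indk; rewrite // !inE xA xDU orbT.
  have /andP[_ /connect_rank] := ltA x xA.
  by rewrite leqNgt (r_edge exk).
- apply/forallP => A; apply/forallP => k; apply/implyP.
  case/and4P => _ _ kU /forall_inP ltA; apply/negP => /orthogonal_indepP[].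
  move=> _ /no_edgeP indk /orthogonal_pairP orthk.
  have kk : k \in k |: (U :\: A) by exact: setU11.
  have kD : k \notin D by apply/negP => kD; have := orthk k k kD kk; rewrite eqxx.
  case: (dom k kD kU) => -[x xDU]; first by case/andP: (orthk x k xDU kk) => _ /negPf->.
  have [xA exk|xA exk] := boolP (x \in A); last first.
    by move: exk; apply/negP; apply: indk; rewrite // !inE xA xDU orbT.
  have /andP[_ /connect_rank] := ltA x xA.
  by rewrite leqNgt (r_edge exk).
- apply/forall_inP => k kD; apply/negP => /orthogonal_indepP[].
  move=> /no_edgeP indk _ /orthogonal_pairP orthk.
  have kU : k \notin U by apply/negP => /(orthk k k (setU11 _ _)); rewrite eqxx.
  case: (dom k kD kU) => -[x xDU].
    by apply/negP; apply: indk; rewrite ?setU11 // inE xDU orbT.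
  by case/andP: (orthk k x (setU11 _ _) xDU) => _ /negPf->.
apply/forall_inP => k kU; apply/negP => /orthogonal_indepP[].
move=> _ /no_edgeP indk /orthogonal_pairP orthk.
have kD : k \notin D by apply/negP => kD; have := orthk k k kD (setU11 _ _); rewrite eqxx.
case: (dom k kD kU) => -[x xDU].
  by case/andP: (orthk x k xDU (setU11 _ _)) => _ /negPf->.
by apply/negP; apply: indk; rewrite ?setU11 // inE xDU orbT.
Qed.

(** Kernels are determined recursively along edges: whether k belongs depends only on
    the in-neighbours of k, which P contains whenever it contains k. *)
Lemma dominating_agree (P : pred T) D D' :
  independent e D -> independent e D' ->
  (forall x y, e x y -> P y -> P x) ->
  (forall k, P k -> k \in D -> k \notin D' -> exists2 d, d \in D' & e d k) ->
  (forall k, P k -> k \in D' -> k \notin D -> exists2 d, d \in D & e d k) ->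
  forall k, P k -> (k \in D) = (k \in D').
Proof.
move=> /no_edgeP indD /no_edgeP indD' Pup domD' domD k.
have [m] := ubnP (\max_x r x - r k); elim: m k => // m IH k; rewrite ltnS => le_m Pk.
have IHk d : e d k -> (d \in D) = (d \in D').
  move=> edk; apply: IH; last exact: Pup edk Pk.
  apply: leq_trans le_m; apply: ltn_sub2l; last exact: r_edge.
  by apply: leq_trans (r_edge edk) _; exact: leq_bigmax.
apply/idP/idP => kD; apply: contraT => nkD.
  have [d dD' edk] := domD' k Pk kD nkD.
  by have := indD d k; rewrite IHk // edk => /(_ dD' kD).
have [d dD edk] := domD k Pk kD nkD.
by have := indD' d k; rewrite -IHk // edk => /(_ dD kD).
Qed.

End Tops.

(** * Flips *)

Section Greedy.

Variables (T : finType) (e : rel T).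
Implicit Types (D U : {set T}) (k x y : T) (s : seq T).

(** At its turn, each k is tested only against the part of D' built so far; the
    remaining members of D' come later in s and have no edge to k, so the test
    may as well use all of D'. *)
Lemma foldl_add_down U0 D' s D : (forall x, ~~ e x x) ->
  pairwise (fun x y => ~~ e y x) s ->
  D \subset D' -> (forall k, k \in D' -> (k \in D) || (k \in s)) ->
  (forall k, k \in s -> (k \in D') && (k \notin D) ->
     [&& k \notin U0, no_edge e [set k] U0 & no_edge e D' [set k]]) ->
  (forall k, k \in s ->
     [&& k \notin U0, no_edge e [set k] U0 & no_edge e D' [set k]] -> k \in D') ->
  foldl (add_down e U0) D s = D'.
Proof.
move=> irr; elim: s D => /= [|k s IH] D.
  move=> _ sDD' sD'D _ _; apply/eqP; rewrite eqEsubset sDD'; apply/subsetP => k /sD'D.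
  by rewrite in_nil orbF.
move=> /andP[/allP later pw] sDD' sD'D nec suf.
have same : no_edge e D [set k] = no_edge e D' [set k].
  apply/no_edgeP/no_edgeP => H x y xD /set1P->; last first.
    by apply: H (set11 k); exact: (subsetP sDD').
  case/orP: (sD'D x xD) => [xD0|]; first exact: H (set11 k).
  by rewrite inE => /predU1P[->|/later].
have EDk : add_down e U0 D k =
    if [&& k \notin U0, no_edge e [set k] U0 & no_edge e D' [set k]]
    then k |: D else D by rewrite /add_down same.
rewrite {}EDk; have ks : k \in k :: s by exact: mem_head.
case: ifP => condk; apply: IH => //.
- by rewrite subUset sub1set (suf k) ?sDD'.
- move=> x /sD'D; rewrite !inE => /orP[->|/orP[->|->]]; by rewrite ?orbT.
- move=> x xs /andP[xD']; rewrite in_setU1 negb_or => /andP[_ xD].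
  by apply: nec; rewrite ?xD' // inE xs orbT.
- by move=> x xs; apply: suf; rewrite inE xs orbT.
- move=> x xD'; case/orP: (sD'D x xD') => [->//|]; rewrite inE => /predU1P[xk|->].
    have [//|xD] := boolP (x \in D).
    by move: condk; rewrite nec // -xk xD' xD.
  by rewrite orbT.
- move=> x xs; apply: nec; by rewrite inE xs orbT.
- by move=> x xs; apply: suf; rewrite inE xs orbT.
Qed.

End Greedy.

Section Flips.

Variables (T : finType) (e : rel T).
Implicit Types (A D U : {set T}) (g k d u x y : T) (s : seq T).

Lemma foldl_add_up_converse D U s :
  foldl (add_up e D) U s = foldl (add_down (converse e) D) U s.
Proof.
elim: s U => //= k s IH U; rewrite IH; congr foldl.
by rewrite /add_up /add_down !(no_edge_converse e).
Qed.

Lemma enumeration_pairwise s (R : rel T) : uniq s ->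
  (forall x y, x \in s -> y \in s -> index x s < index y s -> R x y) ->
  pairwise R s.
Proof.
case: s => // x0 s0; move: (x0 :: s0) => s us H.
apply/(pairwiseP x0) => i j ils jls lt_ij.
by apply: H; rewrite ?mem_nth // !index_uniq.
Qed.

Variables (l l' : seq T).
Hypothesis lin_l : linear_extension e l.
Hypothesis rev_l' : reverse_linear_extension e l'.

Lemma reverse_extension_pairwise : pairwise (fun x y => ~~ e y x) l'.
Proof.
case: rev_l' => -[ul' _] edge; apply: enumeration_pairwise => // x y _ _ lt_xy.
by apply/negP => /edge; rewrite ltnNge ltnW.
Qed.

Lemma extension_pairwise : pairwise (fun x y => ~~ converse e y x) l.
Proof.
case: lin_l => -[ul _] edge; apply: enumeration_pairwise => // x y _ _ lt_xy.
by apply/negP => /edge; rewrite ltnNge ltnW.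
Qed.

(** The delicate point is the first greedy pass: a vertex k not above g, outside D'
    and without an edge from D' has an edge to U' or lies in U'. The vertex of U'
    in question is not above g either, hence already in U0, so k fails the test
    of the algorithm. *)
Lemma flip_eq D U D' U' g :
  dominated_pair e D U -> dominated_pair e D' U' ->
  g \in U -> g \in D' ->
  (forall k, ~~ gle e k g -> (k \in D) = (k \in D')) ->
  (forall k, ~~ gle e g k -> (k \in U) = (k \in U')) ->
  flip e l l' g (D, U) = (D', U').
Proof.
move=> [_ _ orthDU _] [indD' indU' orthDU' dom'] gU gD' eqD eqU.
have noDU := orthogonal_pairP _ _ _ orthDU.
have noDU' := orthogonal_pairP _ _ _ orthDU'.
have noD' := no_edgeP _ _ _ indD'; have noU' := no_edgeP _ _ _ indU'.
have irr x : ~~ e x x by apply/negP; case: lin_l => _ H /H; rewrite ltnn.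
have mem_l k : k \in l by case: lin_l => -[].
have mem_l' k : k \in l' by case: rev_l' => -[].
have anti k : gle e k g -> gle e g k -> k = g.
  have le x y : connect e x y -> index y l <= index x l.
    exact: (@connect_rank _ e (index^~ l) (proj2 lin_l)).
  move=> /le le1 /le le2; rewrite -[k](nth_index g (mem_l k)).
  by have /eqP-> : index k l == index g l; rewrite ?nth_index // eqn_leq le1 le2.
have gDn : g \notin D by apply/negP => /(fun H => noDU g g H gU); rewrite eqxx.
rewrite /flip inE gU orbT /= (negPf gDn) setU0.
set D0 := _ :|: _; set U0 := [set k in U | _].
have sD0 : D0 \subset D'.
  apply/subsetP => k; rewrite !inE => /orP[/andP[kD nk]|/eqP->] //.
  by rewrite -eqD.
have sU0 : U0 \subset U'.
  by apply/subsetP => k; rewrite !inE => /andP[kU nk]; rewrite -eqU.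
have U'U0 u : u \in U' -> ~~ gle e g u -> u \in U0.
  by move=> uU' nu; rewrite inE eqU ?uU' ?nu.
have -> : foldl (add_down e U0) D0 [seq k <- l' | ~~ gle e g k] = D'.
  apply: foldl_add_down => //.
  - by rewrite pairwise_filter ?reverse_extension_pairwise.
  - move=> k kD'; rewrite mem_filter mem_l' andbT !inE -negb_imply.
    have [//|] := boolP (gle e g k); rewrite ?orbT //= orbF => gk.
    have [->|kg] := eqVneq k g; first by rewrite orbT.
    have nkg : ~~ gle e k g by apply: contra kg => kg; rewrite (anti k kg gk).
    by rewrite eqD // kD' nkg.
  - move=> k _ /andP[kD' _]; apply/and3P; split.
    + by apply/negP => /(subsetP sU0) kU'; have := noDU' k k kD' kU'; rewrite eqxx.
    + apply/no_edgeP => x y /set1P-> /(subsetP sU0) yU'.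
      by case/andP: (noDU' k y kD' yU').
    + by apply/no_edgeP => x y xD' /set1P->; apply: noD'.
  - move=> k; rewrite mem_filter => /andP[ngk _] /and3P[kU0 /no_edgeP noU0 /no_edgeP noDk].
    apply: contraT => kD'.
    have kU' : k \notin U' by apply: contra kU0 => /U'U0; apply.
    case: (dom' k kD' kU') => -[x xDU ekx].
      by case/negP: (noDk x k xDU (set11 k)).
    have ngx : ~~ gle e g x by apply: contra ngk; apply: connect_trans; exact: connect1.
    by case/negP: (noU0 k x (set11 k) (U'U0 x xDU ngx)).
congr pair; rewrite foldl_add_up_converse; apply: foldl_add_down => //.
- by rewrite pairwise_filter ?extension_pairwise.
- move=> k kU'; rewrite mem_filter mem_l andbT.
  have [gk|] := boolP (gle e g k); last by move=> /(U'U0 k kU') ->.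
  suff -> : ~~ gle e k g by rewrite orbT.
  by apply/negP => /anti /(_ gk) Ek; have := noDU' g g gD'; rewrite -{1}Ek kU' eqxx => /(_ isT).
- move=> k _ /andP[kU' _]; apply/and3P; split.
  + by apply/negP => kD'; have := noDU' k k kD' kU'; rewrite eqxx.
  + rewrite (no_edge_converse e); apply/no_edgeP => x y xD' /set1P->.
    by case/andP: (noDU' x k xD' kU').
  + by rewrite (no_edge_converse e); apply/no_edgeP => x y /set1P-> yU'; apply: noU'.
- move=> k _; rewrite !(no_edge_converse e) => /and3P[kD' /no_edgeP noDk /no_edgeP noUk].
  apply: contraT => kU'.
  case: (dom' k kD' kU') => -[x xDU ekx].
    by case/negP: (noDk x k xDU (set11 k)).
  by case/negP: (noUk k x (set11 k) xDU).
Qed.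

End Flips.

(** * The isomorphism *)

Section LabelTop.

Variables (T : finType) (e : rel T) (r r' : T -> nat).
Hypothesis ranking : modular_ranking e r.
Hypothesis ranking' : modular_ranking (converse e) r'.
Implicit Types (A D U : {set T}) (g k x y : T) (p q : mop e) (t : top e).

Local Notation Xp p := (mop_val p).1.
Local Notation Yp p := (mop_val p).2.

Definition upper_labels A := lower_labels (converse e) A.

Local Notation Dp p := (lower_labels e (Xp p)).
Local Notation Up p := (upper_labels (Yp p)).

Lemma in_upper_labels A g : (g \in upper_labels A) =
  (g \in A) && (A :&: lperp e (A :&: rperp e [set g]) == [set g]).
Proof. by rewrite inE (rperp_converse e) (lperp_converse e). Qed.

Lemma closed_left p : closed e (Xp p).
Proof. by rewrite mop_lperp closed_lperp. Qed.

Lemma closed_right p : closed (converse e) (Yp p).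
Proof. by rewrite /closed (lperp_converse e) (rperp_converse e) -mop_lperp -mop_rperp. Qed.

Lemma rperp_lower p : rperp e (Dp p) = Yp p.
Proof. by rewrite (rperp_lower_labels ranking) ?closed_left // -mop_rperp. Qed.

Lemma upper_labels_dominate p k : k \in Yp p -> k \notin Up p ->
  exists2 u, u \in Up p & e k u.
Proof. exact: (lower_labels_dominate ranking' (closed_right p)). Qed.

Lemma lower_labels_dominate_mop p k : k \in Xp p -> k \notin Dp p ->
  exists2 d, d \in Dp p & e d k.
Proof. exact: (lower_labels_dominate ranking (closed_left p)). Qed.

Lemma labels_dominated_pair p : dominated_pair e (Dp p) (Up p).
Proof.
split.
- exact: lower_labels_independent ranking _ (closed_left p).
- rewrite -(independent_converse e).
  exact: lower_labels_independent ranking' _ (closed_right p).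
- rewrite orthogonal_rperp rperp_lower; exact: lower_labels_sub.
move=> k kD kU; have [kX|kX] := boolP (k \in Xp p).
  by left; apply: lower_labels_dominate_mop.
have [kY|] := boolP (k \in Yp p); first by right; apply: upper_labels_dominate.
by rewrite -rperp_lower => /notin_rperp[/(negP kD)//|]; left.
Qed.

Lemma label_top_tight p : tight e (Dp p) (Up p).
Proof.
case: ranking => _ r_edge _; apply: (dominated_tight r_edge).
exact: labels_dominated_pair.
Qed.

Definition label_top p : top e := @Top T e (Dp p, Up p) (label_top_tight p).

Definition top_mop t : mop e := mop_of_left e (top_val t).1.

Lemma label_topK : cancel label_top top_mop.
Proof.
move=> p; apply: val_inj; rewrite /= !rperp_lower -mop_lperp.
by case: (mop_val p).
Qed.

Lemma top_dominated t : dominated_pair e (top_val t).1 (top_val t).2.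
Proof.
by case: ranking => _ r_edge _; case: t => -[D U] /= /(tight_dominated r_edge).
Qed.

(** Both U and U' are kernels of the graph induced on rperp D, and an acyclic graph
    has only one kernel. *)
Lemma dominated_pair_unique D U U' :
  dominated_pair e D U -> dominated_pair e D U' -> U = U'.
Proof.
move=> [_ indU orthU domU] [_ indU' orthU' domU'].
have noU := orthogonal_pairP _ _ _ orthU; have noU' := orthogonal_pairP _ _ _ orthU'.
apply/setP => k; case: ranking' => _ r'_edge _.
apply: (@dominating_agree _ _ _ r'_edge xpredT) => //.
- by rewrite (independent_converse e).
- by rewrite (independent_converse e).
- move=> {}k _ kU kU'; have kD : k \notin D.
    by apply/negP => /(noU k k); rewrite eqxx => /(_ kU).
  case: (domU' k kD kU') => // -[d dD].
  by have /andP[_ /negPf->] := noU d k dD kU.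
move=> {}k _ kU' kU; have kD : k \notin D.
  by apply/negP => /(noU' k k); rewrite eqxx => /(_ kU').
case: (domU k kD kU) => // -[d dD].
by have /andP[_ /negPf->] := noU' d k dD kU'.
Qed.

Lemma top_mopK : cancel top_mop label_top.
Proof.
move=> t; apply: val_inj; rewrite /= [RHS]surjective_pairing.
have ED : Dp (top_mop t) = (top_val t).1.
  by apply: (lower_labels_closure ranking); case: (top_dominated t).
have := labels_dominated_pair (top_mop t); rewrite ED => domLab.
by congr pair; rewrite // (dominated_pair_unique domLab (top_dominated t)).
Qed.

Lemma upper_label_step p g : g \in Up p ->
  let q := (p `|` mop_of_left e [set g])%O in
  [/\ Xp p \subset Xp q, g \in Xp q, g \notin Xp p,
      Yp p :&: Xp q = [set g] & Yp q = Yp p :&: rperp e [set g]].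
Proof.
rewrite in_upper_labels => /andP[gY /eqP Eg] q.
have EY : Yp q = Yp p :&: rperp e [set g].
  by rewrite mop_join_right; congr (_ :&: _); rewrite /= rperpK.
have EX : Yp p :&: Xp q = [set g] by rewrite (mop_lperp q) EY.
have gX : g \in Xp q by have := set11 g; rewrite -EX => /setIP[].
split=> //; first exact: (leUl p (mop_of_left e [set g])).
by apply/negP => gp; rewrite mop_rperp in gY; exact: rperp_disjoint gp gY.
Qed.

(** The labels of p and q are compared by dominating_agree: a lower label of q not
    below g has no edge to the label g, so it survives in p, and an upper label of
    p not above g has no edge from g, so it survives in q. *)
Lemma flip_label_top l l' p g :
  linear_extension e l -> reverse_linear_extension e l' -> g \in Up p ->
  flip e l l' g (top_val (label_top p)) =
  top_val (label_top (p `|` mop_of_left e [set g])%O).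
Proof.
move=> lin_l rev_l' gU; have [sXpq gXq gXp EXY EYq] := upper_label_step gU.
set q := (p `|` _)%O in sXpq gXq EXY EYq *.
have r_edge : forall x y, e x y -> r y < r x by case: ranking.
have r'_edge : forall x y, converse e x y -> r' y < r' x by case: ranking'.
have gY : g \in Yp p by have := set11 g; rewrite -EXY => /setIP[].
have [indD indU _ _] := labels_dominated_pair p.
have [indD' indU' _ _] := labels_dominated_pair q.
have sYqp : Yp q \subset Yp p by rewrite EYq subsetIl.
(* otherwise the left side has a label in the overlap of p and q, but it lacks g *)
have EXp : Xp q :&: lperp e [set g] = Xp p.
  have sp : Xp p \subset Xp q :&: lperp e [set g].
    by rewrite subsetI sXpq -perp_galois sub1set -mop_rperp.
  apply/eqP; rewrite eq_sym eqEsubset sp /=; apply/negPn/negP => nsub.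
  have [||| h hD hY] := @lower_label_exists _ _ _ ranking (Xp p) (Xp q :&: lperp e [set g]).
  - exact: closed_left.
  - by rewrite closedI ?closed_left ?closed_lperp.
  - by rewrite properE sp.
  have /setIP[hX] := subsetP (lower_labels_sub _ _) h hD.
  have : h \in Yp p :&: Xp q by rewrite in_setI hX mop_rperp hY.
  by rewrite EXY => /set1P->; rewrite in_lperp1 eqxx.
have gD : g \in Dp q.
  rewrite inE gXq EXp /=; apply/eqP; rewrite -mop_rperp setIC; exact: EXY.
apply: (flip_eq lin_l rev_l' (labels_dominated_pair p) (labels_dominated_pair q)) => //.
- apply: (dominating_agree r_edge indD indD').
  + by move=> x y exy; apply: contra => /connect_trans; apply; apply: connect1.
  + move=> k _ kD; apply: lower_labels_dominate_mop; apply: (subsetP sXpq).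
    exact: (subsetP (lower_labels_sub _ _)) kD.
  + move=> k nkg kD; apply: lower_labels_dominate_mop; rewrite -EXp in_setI.
    rewrite (subsetP (lower_labels_sub _ _) _ kD) in_lperp1.
    rewrite (no_edgeP _ _ _ indD') // andbT.
    by apply: contraNneq nkg => ->; apply: connect0.
apply: (dominating_agree r'_edge); rewrite ?(independent_converse e) //.
- by move=> x y eyx; apply: contra; apply: connect_trans; apply: connect1.
- move=> k ngk kU; apply: upper_labels_dominate; rewrite EYq in_setI.
  rewrite (subsetP (lower_labels_sub _ _) _ kU) in_rperp1.
  rewrite (no_edgeP _ _ _ indU) // andbT.
  by apply: contraNneq ngk => <-; apply: connect0.
move=> k _ kU; apply: upper_labels_dominate; apply: (subsetP sYqp).
exact: (subsetP (lower_labels_sub _ _)) kU.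
Qed.

Lemma upper_label_exists p q : Xp p \proper Xp q ->
  exists2 g, g \in Up p & g \in Xp q.
Proof.
move=> pq; have [||| g gU gX] := @lower_label_exists _ _ _ ranking' (Yp q) (Yp p).
- exact: closed_right.
- exact: closed_right.
- by move: pq; rewrite !properE -!mop_leE.
by exists g => //; rewrite mop_lperp -(rperp_converse e).
Qed.

(** Climbing from p to q, some upper label of p lies in q, so the corresponding cover
    stays below q; conversely each flip of a label top goes to a larger mop. *)
Lemma label_top_le l l' :
  linear_extension e l -> reverse_linear_extension e l' ->
  forall p q, (p <= q)%O = top_le e l l' (label_top p) (label_top q).
Proof.
move=> lin_l rev_l' p q; apply/idP/idP.
  have [m] := ubnP (#|T| - #|Xp p|); elim: m p => // m IH p; rewrite ltnS => le_m le_pq.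
  have [->|npq] := eqVneq p q; first exact: connect0.
  have lt_pq : Xp p \proper Xp q.
    have : (p < q)%O by rewrite lt_neqAle npq.
    by rewrite lt_leAnge properE.
  have [g gU gX] := upper_label_exists lt_pq.
  have [sX gX' gXp _ _] := upper_label_step gU.
  apply: (connect_trans (y := label_top (p `|` mop_of_left e [set g])%O)).
    apply: connect1; apply/exists_inP; exists g => //.
    by rewrite flip_label_top.
  apply: IH.
    apply: leq_trans le_m; apply: ltn_sub2l; last first.
      by apply: proper_card; rewrite properE sX; apply/subsetPn; exists g.
    apply: leq_trans (max_card (Xp q)); exact: proper_card.
  rewrite leUx le_pq /=; apply: closure_sub (closed_left q) _.
  by rewrite sub1set.
rewrite -{2}(label_topK p) -{2}(label_topK q).
move: (label_top p) (label_top q) => s t /connectP[path + ->].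
elim: path s => //= s' path IH s /andP[/exists_inP[g gU /eqP Es'] /IH].
apply: le_trans; rewrite -(top_mopK s) in gU Es'.
rewrite (flip_label_top lin_l rev_l' gU) in Es'.
by rewrite (val_inj Es') label_topK leUl.
Qed.

End LabelTop.

Theorem theorem1p7 (T : finType) (e : rel T) (l l' : seq T)
    (acyclic_e : acyclic e)
    (lin_l : linear_extension e l)
    (rev_l' : reverse_linear_extension e l')
    (trim_mop : trim (mop e)) :
  poset_iso (mop e) (top_le e l l').
Proof.
case: trim_mop => _ [C [maxC modC]].
have ranking := chain_rank_modular lin_l maxC modC.
have ranking' := chain_rank_modular_converse lin_l maxC modC.
exists (label_top ranking ranking'); split; last exact: label_top_le.
by exists (@top_mop _ e); [exact: label_topK | exact: top_mopK].
Qed.
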